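(* Let $n\geq 2$ and let $X_1,\ldots,X_n$ be real random variables on a common probability space (not assumed independent) with finite second moments and nonzero variances. Let $\mu_i=\mathbb{E}(X_i)$, $\sigma_i^2=\mathrm{Var}(X_i)$ (with $\sigma_i>0$) and $\rho_{i,j}=\mathrm{Corr}(X_i,X_j)$ for $i,j=1,\ldots,n$. Then $$GMD_n\;\leq\;\frac{1}{\binom{n}{2}}\sum_{1\leq i<j\leq n}\left[\sqrt{(\sigma_i-\sigma_j\rho_{i,j})^2+\sigma_j^2(1-\rho_{i,j}^2)}+|\mu_i-\mu_j|\right].$$
   Context: The Gini mean difference of $X_1,\ldots,X_n$ is $GMD_n=\frac{1}{\binom{n}{2}}\sum_{1\leq i<j\leq n}\mathbb{E}(|X_i-X_j|)$. $\mathrm{Corr}$ denotes the Pearson correlation coefficient, $\mathrm{Corr}(X_i,X_j)=\mathrm{Cov}(X_i,X_j)/(\sigma_i\sigma_j)$. *)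

(* Defs.v *)
From mathcomp Require Export all_boot all_order all_algebra.
From mathcomp Require Export all_classical all_reals all_analysis.

Set Implicit Arguments.
Unset Strict Implicit.
Unset Printing Implicit Defensive.

Import Order.TTheory GRing.Theory Num.Theory.
Local Open Scope ring_scope.

(* [fine] sends infinite values to 0, so [mean], [sd] and [corr] carry their
   usual meaning when the random variables have finite second moments. *)
Definition mean (d : measure_display) (T : measurableType d) (R : realType)
  (P : probability T R) (X : T -> R) : R := fine 'E_P[X]%E.

Definition sd (d : measure_display) (T : measurableType d) (R : realType)
  (P : probability T R) (X : T -> R) : R := Num.sqrt (fine 'V_P[X]%E).

Definition corr (d : measure_display) (T : measurableType d) (R : realType)
  (P : probability T R) (X Y : T -> R) : R :=
  fine (covariance P X Y) / (sd P X * sd P Y).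

(* Gini mean difference, kept in the extended reals: an infinite E|X_i - X_j|
   is not collapsed to a real number. *)
Definition GMD (d : measure_display) (T : measurableType d) (R : realType)
  (P : probability T R) (n : nat) (X : 'I_n -> {RV P >-> R}) : \bar R :=
  ((('C(n, 2))%:R^-1)%:E *
   \sum_(i < n) \sum_(j < n | (i < j)%N)
     'E_P[fun w => (`|X i w - X j w|)%R])%E.

(* Main.v *)
Require Import Defs.
From mathcomp Require Import all_boot all_order all_algebra.
From mathcomp Require Import all_classical all_reals all_analysis.
From mathcomp Require Import ring.
Import Order.TTheory GRing.Theory Num.Theory.
Local Open Scope ring_scope.

(** For each pair put D = X_i - X_j. Since the variance of |D| is nonnegative,
    (E|D|)^2 <= E(D^2) = Var D + (E D)^2, and subadditivity of the square root
    gives E|D| <= sqrt (Var D) + |E D|. Here E D = mu_i - mu_j, and the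
    radicand of the theorem is Var D in disguise: it expands to
    sigma_i^2 + sigma_j^2 - 2 sigma_i sigma_j rho_ij, where
    sigma_i sigma_j rho_ij is the covariance of X_i and X_j because the
    standard deviations do not vanish. The theorem is the average over all
    pairs i < j of this bound ([expectation_abs_le_sd_mean] and
    [variance_sub_corr]). *)

Lemma sqrtD_sqr_le (R : rcfType) (v m : R) : 0 <= v ->
  Num.sqrt (v + m ^+ 2) <= Num.sqrt v + `|m|.
Proof.
move=> v0; have s0 := sqrtr_ge0 v; have m0 := normr_ge0 m.
rewrite -[leRHS]ger0_norm ?addr_ge0// -[leRHS]sqrtr_sqr.
rewrite ler_sqrt ?sqr_ge0// sqrrD sqr_sqrtr// real_normK ?num_real//.
by rewrite -addrA lerD2l lerDr mulrn_wge0// mulr_ge0.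
Qed.

Section second_moment.
Context (d : measure_display) (T : measurableType d) (R : realType)
  (P : probability T R).

(** Square integrability is given as a finite expectation, whereas the
    calculus of variances is stated for members of L^2. *)
Lemma Lfun2_of_second_moment (f : T -> R) : measurable_fun [set: T] f ->
  ('E_P[fun w => (f w ^+ 2)%R] < +oo)%E -> f \in Lfun P 2%:E.
Proof.
move=> mf f2; rewrite inE; apply/andP; split; rewrite inE//=.
rewrite /finite_norm; apply: (@lty_poweRy _ _ 2) => //.
rewrite powR_Lnorm//.
suff -> : (\int[P]_x `|(f x)%:E| `^ 2 = 'E_P[fun w => (f w ^+ 2)%R])%E by [].
rewrite expectation.unlock; apply: eq_integral => w _ /=.
by rewrite powR_mulrn// -normrX ger0_norm ?sqr_ge0.
Qed.

Lemma Lfun2_norm (f : T -> R) : f \in Lfun P 2%:E ->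
  (fun w => `|f w|) \in Lfun P 2%:E.
Proof.
move=> f2; have mf : measurable_fun [set: T] f.
  by have /sub_Lfun_mfun := f2; rewrite inE.
apply: Lfun2_of_second_moment; first exact: measurableT_comp.
suff : ('E_P[fun w => (`|f w| ^+ 2)%R])%E \is a fin_num.
  by rewrite fin_numE => /andP[_]; rewrite -ltey.
apply: expectation_fin_num; apply/Lfun1_integrable.
under [X in integrable _ _ X]eq_fun => w do rewrite /= real_normK ?num_real//.
exact: Lfun2_integrable_sqr.
Qed.

(** Both [f] and [|f|] have the same second moment, so nonnegativity of the
    variance of [|f|] reads (E|f|)^2 <= Var f + (E f)^2. *)
Lemma expectation_abs_le_sd_mean (f : T -> R) : f \in Lfun P 2%:E ->
  ('E_P[fun w => `|f w|%R] <= (sd P f + `|mean P f|)%:E)%E.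
Proof.
move=> f2; have g2 := Lfun2_norm _ f2.
have Pfin : P setT \is a fin_num := fin_num_measure P _ measurableT.
have Ef := expectation_fin_num (Lfun_subset12 Pfin f2).
have Eg := expectation_fin_num (Lfun_subset12 Pfin g2).
have Vf := variance_fin_num f2.
set g : T -> R := fun w => `|f w|.
have sqE : g ^+ 2 = f ^+ 2.
  by apply/funext => w; rewrite !fctE real_normK ?num_real.
have Eg0 : (0 <= fine 'E_P[g]%E)%R by apply/fine_ge0/expectation_ge0 => w; exact: normr_ge0.
have key : (fine 'E_P[g]%E ^+ 2 <= fine 'V_P[f]%E + fine 'E_P[f]%E ^+ 2)%R.
  have := variance_ge0 P g; rewrite varianceE// sqE => Vg.
  rewrite -lee_fin EFinD !EFin_expe !fineK// varianceE// subeK; last first.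
    by rewrite fin_numX.
  by move: Vg; rewrite sube_ge0 // fin_numX.
rewrite -[leLHS]fineK// lee_fin /sd /mean.
apply: le_trans (sqrtD_sqr_le _ _ _ (fine_ge0 (variance_ge0 P f))).
by rewrite -[leLHS]ger0_norm// -[leLHS]sqrtr_sqr ler_wsqrtr.
Qed.

Lemma mean_sub (f g : T -> R) : f \in Lfun P 2%:E -> g \in Lfun P 2%:E ->
  mean P (f \- g) = mean P f - mean P g.
Proof.
move=> f2 g2.
have Pfin : P setT \is a fin_num := fin_num_measure P _ measurableT.
have f1 := Lfun_subset12 Pfin f2; have g1 := Lfun_subset12 Pfin g2.
by rewrite /mean expectationB// fineB ?expectation_fin_num.
Qed.

(** Both sides equal Var f + Var g - 2 Cov(f, g). On the left the squares of
    the correlation cancel, and nonvanishing standard deviations turn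
    sd f * sd g * corr f g back into the covariance. *)
Lemma variance_sub_corr (f g : T -> R) :
  f \in Lfun P 2%:E -> g \in Lfun P 2%:E ->
  ('V_P[f] != 0)%E -> ('V_P[g] != 0)%E ->
  (sd P f - sd P g * corr P f g) ^+ 2 + sd P g ^+ 2 * (1 - corr P f g ^+ 2)
  = fine 'V_P[(f \- g)%R]%E.
Proof.
move=> f2 g2 Vf0 Vg0.
have Pfin : P setT \is a fin_num := fin_num_measure P _ measurableT.
have f1 := Lfun_subset12 Pfin f2; have g1 := Lfun_subset12 Pfin g2.
have Cfg : covariance P f g \is a fin_num.
  by apply: covariance_fin_num => //; exact: Lfun2_mul_Lfun1.
have Vf := variance_fin_num f2; have Vg := variance_fin_num g2.
have sd_sqr h : sd P h ^+ 2 = fine 'V_P[h]%E.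
  by rewrite sqr_sqrtr// fine_ge0// variance_ge0.
have sd_neq0 h : h \in Lfun P 2%:E -> ('V_P[h] != 0)%E -> sd P h != 0.
  move=> h2 Vh0; rewrite -sqrf_eq0 sd_sqr fine_eq0//; exact: variance_fin_num.
have sf0 := sd_neq0 _ f2 Vf0; have sg0 := sd_neq0 _ g2 Vg0.
rewrite varianceB// fineB ?fin_numD ?Vf ?Vg ?fin_numM// fineD// fineM//=.
by rewrite -!sd_sqr /corr; field; rewrite ?sf0 ?sg0.
Qed.

End second_moment.

Theorem theorem1 (d : measure_display) (T : measurableType d) (R : realType)
    (P : probability T R) (n : nat) (hn : (2 <= n)%N)
    (X : 'I_n -> {RV P >-> R})
    (hX2 : forall i : 'I_n, ('E_P[fun w => ((X i w) ^+ 2)%R] < +oo)%E)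
    (hV : forall i : 'I_n, ('V_P[X i] != 0)%E) :
  let mu i := mean P (X i) in
  let sigma i := sd P (X i) in
  let rho i j := corr P (X i) (X j) in
  (GMD X <=
    ('C(n, 2)%:R^-1 *
     \sum_(i < n) \sum_(j < n | (i < j)%N)
       (Num.sqrt ((sigma i - sigma j * rho i j) ^+ 2
                  + sigma j ^+ 2 * (1 - rho i j ^+ 2))
        + `|mu i - mu j|))%:E)%E.
Proof.
cbv zeta.
have X2 i : (X i : T -> R) \in Lfun P 2%:E.
  by apply: Lfun2_of_second_moment (hX2 i).
rewrite /GMD EFinM; apply: lee_wpmul2l; first by rewrite lee_fin invr_ge0.
rewrite -sumEFin; apply: lee_sum => i _.
rewrite -sumEFin; apply: lee_sum => j _.
rewrite -mean_sub// variance_sub_corr//.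
apply: (@expectation_abs_le_sd_mean _ _ _ _ (X i \- X j)).
by apply: rpredB; rewrite ?lee1n.
Qed.
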